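(* Let $n > k$ and $m$ be positive integers and $H > 0$. Let $\Pi$ be any set of linear-programming instances $\pi = (\bm{c}, \bm{A}, \bm{b}) \in \mathbb{R}^n \times \mathbb{R}^{m\times n} \times \mathbb{R}^m$, each representing the LP $\max\{\bm{c}^\top \bm{x} : \bm{A}\bm{x} \le \bm{b},\ \bm{x}\in\mathbb{R}^n\}$, such that for every $\pi \in \Pi$, $\bm{x} = \mathbf{0}_n$ is feasible and the optimal value is at most $H$. For $\bm{P} \in \mathbb{R}^{n\times k}$ and $\pi = (\bm{c},\bm{A},\bm{b}) \in \Pi$ define $u(\bm{P}, \pi) = \max\{\bm{c}^\top \bm{P}\bm{y} : \bm{A}\bm{P}\bm{y} \le \bm{b},\ \bm{y} \in \mathbb{R}^k\}$, and let $\mathcal{U} = \{u(\bm{P}, \cdot) : \Pi \to \mathbb{R} \mid \bm{P} \in \mathbb{R}^{n\times k}\}$. Then $\mathrm{pdim}(\mathcal{U}) = \mathrm{O}(nk^2 \log(mk))$, where the constant hidden in $\mathrm{O}$ is absolute (independent of $n, k, m, H$ and $\Pi$).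
   Context: Pseudo-dimension: for a class $\mathcal{U}$ of real-valued functions on a set $\Pi$, a finite set $\{\pi_1,\dots,\pi_N\} \subseteq \Pi$ is shattered by $\mathcal{U}$ if there exist thresholds $t_1,\dots,t_N \in \mathbb{R}$ such that each of the $2^N$ possible outcomes of the family of indicators $(\mathbb{1}[u(\pi_i) \ge t_i])_{i=1}^N$ is realized by some $u \in \mathcal{U}$. $\mathrm{pdim}(\mathcal{U})$ is the maximum size of a set shattered by $\mathcal{U}$. Under the stated assumptions $u(\bm{P},\pi) \in [0,H]$ for all $\bm{P}$ and $\pi$ (since $\bm{y}=\mathbf{0}_k$ is feasible and $\bm{P}\bm{y}$ is feasible for the original LP).
   Formalization: The bound is proved with 1 + log(mk) in place of log(mk); the two agree up to an absolute factor unless m = k = 1, where log(mk) = 0 and the literal claim fails (max x₁ subject to x₁ ≤ 1 with n = 2 already gives pdim ≥ 1). *)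

(* Defs.v *)
From HB Require Import structures.
From mathcomp Require Import all_boot all_order all_algebra.
From mathcomp Require Import all_classical all_reals.
From mathcomp Require Import exp.
Set Implicit Arguments. Unset Strict Implicit. Unset Printing Implicit Defensive.
Import Order.TTheory GRing.Theory Num.Theory.
Local Open Scope classical_set_scope.
Local Open Scope ring_scope.

Section LP.
Variables (R : realType) (n m : nat).

Definition lp_instance := ('cV[R]_n * 'M[R]_(m, n) * 'cV[R]_m)%type.

Definition inst_c (pi : lp_instance) : 'cV[R]_n := pi.1.1.
Definition inst_A (pi : lp_instance) : 'M[R]_(m, n) := pi.1.2.
Definition inst_b (pi : lp_instance) : 'cV[R]_m := pi.2.

Definition cV_le (p : nat) (u v : 'cV[R]_p) : Prop := forall i, u i 0 <= v i 0.

Definition lp_feasible (pi : lp_instance) (x : 'cV[R]_n) : Prop :=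
  cV_le (inst_A pi *m x) (inst_b pi).

Definition lp_obj (pi : lp_instance) (x : 'cV[R]_n) : R :=
  ((inst_c pi)^T *m x) 0 0.

(* u(P, pi) = max { c^T P y : A P y <= b, y in R^k } (supremum; it is attained
   under the standing assumptions of the theorem). *)
Definition u_proj (k : nat) (P : 'M[R]_(n, k)) (pi : lp_instance) : R :=
  sup [set lp_obj pi (P *m y) | y in [set y : 'cV[R]_k | lp_feasible pi (P *m y)]].

End LP.

Definition pshattered (R : realType) (T : eqType) (U : set (T -> R)) (s : seq T) : Prop :=
  uniq s /\
  exists t : 'I_(size s) -> R,
    forall pat : 'I_(size s) -> bool,
      exists2 u, U u & forall i : 'I_(size s), (t i <= u (tnth (in_tuple s) i)) = pat i.

(* Main.v *)
Require Import Defs.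
From HB Require Import structures.
From mathcomp Require Import all_boot all_order all_algebra.
From mathcomp Require Import all_classical all_reals.
From mathcomp Require Import exp.
From mathcomp Require Import topology normedtype derive.
From mathcomp Require Import ring lra zify.
Import Order.TTheory GRing.Theory Num.Theory.
Import numFieldNormedType.Exports.
Local Open Scope classical_set_scope.
Local Open Scope ring_scope.

(* Whether [t <= u_proj P pi] depends only on the signs of [(m + 2) (m + k)^k] polynomials of degree
   at most [3 k] in the [D = n k] entries of [P]: the optimum is attained at a solution of [k]
   independent equations taken among the tight constraints and the equations [y_j = 0], and Cramer's
   rule makes this solution rational in [P].

   To count sign patterns, group the polynomials of [K D] instances into [D] groups with products
   [g_a] of degree [e], and minimise, over the closure of each sign cell,
     [\sum_a (z_a g_a(x) - 1)^2 + eps (\sum_i x_i^(2E) + \sum_a z_a^(2E))]   with [E = e + 2].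
   On the boundary of a cell some [g_a] vanishes and the value is at least 1, while inside it is
   small, so every nonempty cell contains a critical point.  The critical equations read
   [v_j^(2E-1) = h_j(v)] with [deg h_j < 2E-1], hence every polynomial function on the set of critical
   points is a combination of monomials with all exponents below [2E-1], and there are at most
   [(2E-1)^(2D)] of them.  A shattered set of size [K D] therefore forces [2^K <= (2e+3)^2].  Spending
   only one auxiliary variable [z_a] per group keeps [log n] out of the bound. *)

Set Implicit Arguments.
Unset Strict Implicit.
Unset Printing Implicit Defensive.

(** * Polynomial functions and pure-power systems *)

(* [polfun e f]: [f] is a polynomial function of total degree at most [e]. *)
Inductive polfun (R : comNzRingType) (I : Type) :
    nat -> ((I -> R) -> R) -> Prop :=
| PolConst e c : polfun e (fun=> c)
| PolVar e i : polfun e.+1 (fun x => x i)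
| PolAdd e f g : polfun e f -> polfun e g -> polfun e (fun x => f x + g x)
| PolMul e1 e2 f g :
    polfun e1 f -> polfun e2 g -> polfun (e1 + e2) (fun x => f x * g x).

Section Polfun.
Context {R : comNzRingType} {I : Type}.
Implicit Types f g : (I -> R) -> R.

Lemma polfun_weaken e e' f : (e <= e')%N -> polfun e f -> polfun e' f.
Proof.
move=> le pf; elim: pf e' le => {e f}.
- by move=> e c e' _; apply: PolConst.
- by move=> e i [//|e'] _; apply: PolVar.
- by move=> e f g _ IHf _ IHg e' le; apply: PolAdd; [apply: IHf|apply: IHg].
- move=> e1 e2 f g _ IHf pg IHg e' le.
  have e1e' : (e1 <= e')%N by apply: leq_trans le; apply: leq_addr.
  rewrite -(subnKC e1e'); apply: PolMul; first exact: IHf.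
  by apply: IHg; rewrite leq_subRL.
Qed.

Lemma polfun_scale e c f : polfun e f -> polfun e (fun x => c * f x).
Proof. by move=> pf; rewrite -[e]add0n; apply: PolMul => //; apply: PolConst. Qed.

Lemma polfun_opp e f : polfun e f -> polfun e (fun x => - f x).
Proof. by move=> pf; under eq_fun do rewrite -mulN1r; apply: polfun_scale. Qed.

Lemma polfun_sub e f g : polfun e f -> polfun e g -> polfun e (fun x => f x - g x).
Proof. by move=> pf pg; apply: PolAdd => //; apply: polfun_opp. Qed.

Lemma polfun_sum (T : Type) (r : seq T) (p : pred T) e (F : T -> (I -> R) -> R) :
  (forall t, p t -> polfun e (F t)) -> polfun e (fun x => \sum_(t <- r | p t) F t x).
Proof.
move=> pF; elim: r => [|t r IH].
  by under eq_fun do rewrite big_nil; apply: PolConst.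
under eq_fun do rewrite big_cons.
by case: (boolP (p t)) => [/pF pt|_] //; apply: PolAdd.
Qed.

Lemma polfun_prod (T : Type) (r : seq T) e (F : T -> (I -> R) -> R) :
  (forall t, polfun e (F t)) -> polfun (size r * e) (fun x => \prod_(t <- r) F t x).
Proof.
move=> pF; elim: r => [|t r IH].
  by under eq_fun do rewrite big_nil; apply: PolConst.
by under eq_fun do rewrite big_cons; apply: PolMul.
Qed.

Lemma polfun_exp e f n : polfun e f -> polfun (n * e) (fun x => f x ^+ n).
Proof.
move=> pf; elim: n => [|n IH]; first exact: PolConst.
by under eq_fun do rewrite exprS; apply: PolMul.
Qed.

Lemma polfun_det e n (M : (I -> R) -> 'M[R]_n) :
  (forall i j, polfun e (fun x => M x i j)) ->
  polfun (n * e) (fun x => \det (M x)).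
Proof.
move=> pM; rewrite /determinant; apply: polfun_sum => s _.
apply: polfun_scale.
by rewrite -[X in (X * e)%N]size_enum_ord enumT; apply: polfun_prod.
Qed.

End Polfun.

Section Box.
Context {R : fieldType} {I S : finType}.
Variables (z : S -> I -> R) (E : nat).

Definition box_mx :=
  \matrix_(a < #|{ffun I -> 'I_E}|, s < #|S|) \prod_i z (enum_val s) i ^+ enum_val a i.

Let evalrow (f : (I -> R) -> R) : 'rV_#|S| := \row_s f (z (enum_val s)).

(** Functions are identified with their values on the sample, so this is reducibility to monomials
    with all exponents below [E], modulo functions vanishing at the points. *)
Let spanned f := (evalrow f <= box_mx)%MS.

Let monom (b : I -> nat) (x : I -> R) := \prod_i x i ^+ b i.

(** The cofactor [phi] is what lets the induction pass through products: [f * g * phi] is treated as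
    [f] with cofactor [g * phi], then [g] with cofactor a monomial times [phi]. *)
Let spanned_polfun e h phi : polfun e h ->
  (forall b : I -> nat, (\sum_i b i <= e)%N -> spanned (fun x => monom b x * phi x)) ->
  spanned (fun x => h x * phi x).
Proof.
move=> ph; elim: ph phi => {e h}.
- move=> e c phi /(_ (fun=> 0%N)); rewrite big1 // => /(_ isT) sp.
  rewrite /spanned; suff -> : evalrow (fun x => c * phi x) =
     c *: evalrow (fun x => monom (fun=> 0%N) x * phi x) by apply: scalemx_sub.
  by apply/rowP => s; rewrite !mxE /monom big1 ?mul1r// => i _; rewrite expr0.
- move=> e i phi /(_ (fun j => (j == i) : nat)).
  rewrite (bigD1 i) //= eqxx big1 ?addn0; last by move=> j /negbTE ->.
  move=> /(_ isT); rewrite /spanned; congr (_ <= _)%MS.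
  apply/rowP => s; rewrite !mxE /monom (bigD1 i)//= eqxx expr1 big1 ?mulr1//.
  by move=> j /negbTE ->.
- move=> e f g _ IHf _ IHg phi H.
  rewrite /spanned; suff -> : evalrow (fun x => (f x + g x) * phi x) =
     evalrow (fun x => f x * phi x) + evalrow (fun x => g x * phi x).
    by apply: addmx_sub; [apply: IHf|apply: IHg].
  by apply/rowP => s; rewrite !mxE mulrDl.
- move=> e1 e2 f g _ IHf _ IHg phi H.
  rewrite (_ : (fun x => _) = (fun x => f x * (g x * phi x))); last first.
    by apply/funext => x; rewrite mulrA.
  apply: IHf => b b1.
  rewrite (_ : (fun x => _) = (fun x => g x * (monom b x * phi x))); last first.
    by apply/funext => x; rewrite mulrCA.
  apply: IHg => c c2.
  have := H (fun i => b i + c i)%N; rewrite big_split/= leq_add// => /(_ isT).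
  congr (is_true (spanned _)); apply/funext => x.
  rewrite mulrA [monom c x * _]mulrC; congr (_ * _).
  by rewrite /monom -big_split/=; apply: eq_bigr => i _; rewrite exprD.
Qed.

(** Replacing [x_i ^ E] by [h i] lowers the total degree, so on the sample every polynomial reduces
    to box monomials. Since polynomials separate the points, these monomials span all functions on
    the sample, and the rank of [box_mx] bounds [#|S|]. *)
Lemma card_pure_power_zeros (e : nat) (h : I -> (I -> R) -> R) : (e < E)%N ->
  (forall i, polfun e (h i)) -> (forall s i, z s i ^+ E = h i (z s)) ->
  injective z -> (#|S| <= E ^ #|I|)%N.
Proof.
move=> eE ph zE zinj.
(* Induction on a bound for the total degree: a monomial outside the box has some exponent at least
   [E], and trading [x_i ^ E] for [h i] strictly lowers the degree because [e < E]. *)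
have sp_monom w b : (\sum_i b i < w)%N -> spanned (monom b).
  elim: w b => // w IH b bw.
  have [/forallP bE|/forallPn[i]] := boolP [forall i, (b i < E)%N].
    pose a : {ffun I -> 'I_E} := [ffun i => Ordinal (bE i)].
    rewrite /spanned (_ : evalrow _ = row (enum_rank a) box_mx) ?row_sub//.
    apply/rowP => s; rewrite !mxE enum_rankK.
    by apply: eq_bigr => i _; rewrite ffunE.
  rewrite -leqNgt => bE.
  pose b' j := (if j == i then b i - E else b j)%N.
  have sb : (\sum_i b i = E + \sum_i b' i)%N.
    rewrite (bigD1 i)//= [in RHS](bigD1 i)//= {1}/b' eqxx addnA subnKC//.
    by congr addn; apply: eq_bigr => j /negbTE ji; rewrite /b' ji.
  suff : spanned (fun x => h i x * monom b' x).
    rewrite /spanned; congr (_ <= _)%MS; apply/rowP => s; rewrite !mxE -zE.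
    rewrite /monom (bigD1 i)//= [in RHS](bigD1 i)//= {1}/b' eqxx mulrA -exprD.
    rewrite subnKC//; congr (_ * _).
    by apply: eq_bigr => j /negbTE ji; rewrite /b' ji.
  apply: (@spanned_polfun e) => // c ce.
  suff : spanned (monom (fun i => c i + b' i)%N).
    congr (is_true (spanned _)); apply/funext => x.
    by rewrite /monom -big_split/=; apply: eq_bigr => j _; rewrite exprD.
  apply: IH; rewrite big_split/=; rewrite sb ltnS in bw.
  apply: leq_trans bw; rewrite -addSn leq_add2r.
  exact: leq_ltn_trans ce eE.
have sp_pol d f : polfun d f -> spanned f.
  move=> pf; rewrite (_ : f = fun x => f x * (fun=> 1) x); last first.
    by apply/funext => x; rewrite mulr1.
  apply: (@spanned_polfun d) => // b _.
  rewrite (_ : (fun x => _) = monom b); last by apply/funext => x; rewrite mulr1.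
  exact: sp_monom (ltnSn _).
have full : row_full box_mx.
  rewrite -sub1mx; apply/row_subP => s0.
  (* Lagrange interpolation: [g s] is a linear form vanishing at point [s] but not at [s0], or the
     constant 1 when [s = s0]; the product of all [g s] vanishes on the sample except at [s0]. *)
  have diff s : exists g, [/\ exists d, polfun d g,
      g (z (enum_val s)) = (s == s0)%:R * g (z (enum_val s0)) & g (z (enum_val s0)) != 0].
    case: eqVneq => [->|sneq] /=.
      exists (fun=> 1); split; [by exists 0%N; apply: PolConst|by rewrite mul1r|exact: oner_neq0].
    have [i zi] : exists i, z (enum_val s) i != z (enum_val s0) i.
      apply/existsP; apply: contra_neqT sneq; rewrite negb_exists => /forallP eq.
      apply/enum_val_inj/zinj/funext => i.
      by have := eq i; rewrite negbK => /eqP.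
    exists (fun x => x i + - z (enum_val s) i); split.
    - by exists 1%N; apply: PolAdd; [apply: PolVar|apply: PolConst].
    - by rewrite subrr mul0r.
    - by rewrite subr_eq0 eq_sym.
  have [g gP] := choice diff.
  have [d pd] := choice (fun s => let: And3 p _ _ := gP s in p).
  have pG : polfun (size (index_enum 'I_#|S|) * \max_s d s)
                   (fun x => \prod_s g s x).
    apply: polfun_prod => s; apply: (polfun_weaken _ (pd s)).
    exact: (leq_bigmax (F := d)).
  have G0 : \prod_s g s (z (enum_val s0)) != 0.
    by apply/prodf_neq0 => s _; case: (gP s).
  suff : row s0 1%:M = (\prod_s g s (z (enum_val s0)))^-1 *:
           evalrow (fun x => \prod_s g s x).
    by move->; apply: scalemx_sub; exact: sp_pol pG.
  apply/rowP => s; rewrite !mxE [s0 == s]eq_sym; case: eqVneq => [->|sneq].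
    by rewrite mulVf.
  case: (gP s) => _ + _; rewrite (negbTE sneq) mul0r => gs0.
  by rewrite [X in _ * X](bigD1 s)//= gs0 mul0r mulr0.
move: full; rewrite /row_full => /eqP <-.
by apply: leq_trans (rank_leq_row _) _; rewrite card_ffun card_ord.
Qed.

End Box.

Lemma polfun_reindex (R : comNzRingType) (I J : Type) (h : I -> J) e
    (f : (I -> R) -> R) :
  polfun e f -> polfun e (fun v : J -> R => f (fun i => v (h i))).
Proof.
by elim=> {e f} [e c|e i|e f g _ pf _ pg|e1 e2 f g _ pf _ pg];
  [apply: PolConst|apply: PolVar|apply: PolAdd|apply: PolMul].
Qed.

(** * Minima and critical points of polynomial functions *)

Section Critical.
Context {R : realType} {J : finType}.
Implicit Types (v : J -> R) (j : J) (f F : (J -> R) -> R).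

Definition move_coord v j (t : R) : J -> R := fun i => v i + t * (i == j)%:R.

Lemma move_coord0 v j : move_coord v j 0 = v.
Proof. by apply/funext => i; rewrite /move_coord mul0r addr0. Qed.

(** The crude degree bound [e] for the derivative is sharp enough later, where [2 * e.+1] only has
    to stay below [2E - 1 = 2e + 3]. *)
Lemma polfun_partial e f j : polfun e f -> exists2 f', polfun e f' &
  forall v (t : R), is_derive t 1 (fun t => f (move_coord v j t)) (f' (move_coord v j t)).
Proof.
elim=> {e f}.
- by move=> e c; exists (fun=> 0) => [|v t]; [apply: PolConst|apply: is_derive_cst].
- move=> e i; exists (fun=> (i == j)%:R) => [|v t]; first exact: PolConst.
  have -> : (fun t => move_coord v j t i) = cst (v i) + id * cst (i == j)%:R by [].
  apply: is_derive_eq => /=.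
  by rewrite add0r scaler0 add0r -[RHS]mulr1.
- move=> e f g _ [f' pf' df] _ [g' pg' dg].
  exists (fun x => f' x + g' x) => [|v t]; first exact: PolAdd.
  by have := is_deriveD (df v t) (dg v t).
- move=> e1 e2 f g pf [f' pf' df] pg [g' pg' dg].
  exists (fun x => f x * g' x + g x * f' x) => [|v t].
    by apply: PolAdd; [|rewrite addnC]; apply: PolMul.
  by have := is_deriveM (df v t) (dg v t).
Qed.

Lemma polfun_continuous e f : polfun e f ->
  continuous (fun w : 'rV[R]_#|J| => f (fun j => w ord0 (enum_rank j))).
Proof.
elim=> {e f} [e c|e j|e f g _ cf _ cg|e1 e2 f g _ cf _ cg] w.
- exact: cst_continuous.
- exact: coord_continuous.
- exact: (cvgD (cf w) (cg w)).
- exact: (cvgM (cf w) (cg w)).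
Qed.

(** The feasible set is closed by continuity and lies in a cube, hence is compact. Points are moved
    to row vectors, where the extreme value theorem applies. *)
Lemma polfun_min (T : finType) (c : T -> (J -> R) -> R) e F (M : R) v0 :
  (forall t, exists e', polfun e' (c t)) -> polfun e F ->
  (forall v, (forall t, 0 <= c t v) -> forall j, `|v j| <= M) ->
  (forall t, 0 <= c t v0) ->
  exists2 v, (forall t, 0 <= c t v) &
    forall w, (forall t, 0 <= c t w) -> F v <= F w.
Proof.
move=> pc pF bounded v0P.
pose val (w : 'rV[R]_#|J|) j := w ord0 (enum_rank j).
pose row v : 'rV[R]_#|J| := \row_j v (enum_val j).
have rowK v : val (row v) = v.
  by apply/funext => j; rewrite /val mxE enum_rankK.
pose K := [set w | forall t, 0 <= c t (val w)].
have K0 : K !=set0 by exists (row v0) => t; rewrite rowK.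
have compactK : compact K.
  apply: (@subclosed_compact _ _ [set w : 'rV[R]_#|J| | forall i, `[- M, M]%classic (w ord0 i)]).
  - rewrite (_ : K = \bigcap_(t in setT) ((fun w => c t (val w)) @^-1` [set y | 0 <= y])).
      apply: closed_bigI => t _; have [e' pct] := pc t.
      apply: preimage_closed; last exact: closed_ge.
      move=> w _; exact: (@polfun_continuous _ _ pct w).
    by apply/seteqP; split=> w Kw t; [move=> _; exact: Kw|exact: (Kw t I)].
  - exact: (@rV_compact R _ (fun=> `[- M, M]%classic) (fun=> @segment_compact R _ _)).
  - move=> w Kw i /=; rewrite in_itv/= -ler_norml.
    by rewrite -[i]enum_valK; apply: bounded Kw _.
have [w Kw minw] := compact_EVT_min K0 compactK
  (continuous_subspaceT (@polfun_continuous _ _ pF)).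
exists (val w) => [|v vP]; first by rewrite inE in Kw.
rewrite -[in F v](rowK v); apply: minw.
by rewrite inE => t; rewrite rowK.
Qed.

(** Finitely many strict inequalities persist near [v], so [v] is a local minimum along each
    coordinate line and the derivative vanishes there. *)
Lemma polfun_interior_min (T : finType) (c : T -> (J -> R) -> R) e F v j :
  (forall t, exists e', polfun e' (c t)) -> polfun e F ->
  (forall t, 0 < c t v) ->
  (forall w, (forall t, 0 <= c t w) -> F v <= F w) ->
  is_derive (0 : R) 1 (fun t => F (move_coord v j t)) 0.
Proof.
move=> pc pF cv minv.
have near_t t : \forall s \near (0 : R), 0 <= c t (move_coord v j s).
  have [e' pct] := pc t.
  have [c' _ dc] := polfun_partial j pct.
  have cont : {for (0 : R), continuous (fun s => c t (move_coord v j s))}.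
    apply/differentiable_continuous/derivable1_diffP.
    by have [] := dc v 0.
  have pos : 0 < c t (move_coord v j 0) by rewrite move_coord0.
  have := cvgr_gt _ cont _ pos.
  by move=> /(_ (nbhs_filter (0 : R))); apply: filterS => s; exact: ltW.
have near0 := @filter_forall _ _ _ _ (nbhs_filter (0 : R)) near_t.
have /nbhs_ballP[r /= r0 sub] := near0.
have [F' _ dF] := polfun_partial j pF.
apply: (@derive1_at_min _ _ (- r) r).
- lra.
- by move=> t _; have [] := dF v t.
- by rewrite in_itv/=; lra.
- move=> t; rewrite in_itv/= move_coord0 => tr; apply: minv.
  have : ball (0 : R) r t by rewrite /ball/= sub0r normrN ltr_norml.
  by move=> /sub.
Qed.

End Critical.

(** * Counting sign patterns *)

Section SignPatterns.
Context {R : realType} {I A L S : finType}.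
Variables (d : nat) (f : A -> L -> (I -> R) -> R) (x : S -> I -> R).
Hypothesis pf : forall a l, polfun d (f a l).

Let J : finType := (I + A)%type.
Let e := (#|L| * d)%N.
(** The least integer for which [2E - 1] exceeds [2 * e.+1], the degree bound of [Phi] and of its
    partial derivatives. *)
Let E := e.+2.
Let g a (v : J -> R) := \prod_l f a l (fun i => v (inl i)).
Let Phi (v : J -> R) := \sum_a (v (inr a) * g a v - 1) ^+ 2.
Let powsum (v : J -> R) := \sum_j v j ^+ E.*2.

Let polfun_g a : polfun e (g a).
Proof.
rewrite /e cardT enumT; apply: polfun_prod => l.
exact: (polfun_reindex inl (pf a l)).
Qed.

Let polfun_Phi : polfun (2 * e.+1) Phi.
Proof.
apply: polfun_sum => a _; apply: (polfun_exp (f := fun v : J -> R => v (inr a) * g a v - 1)).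
apply: polfun_sub; last exact: PolConst.
exact: (PolMul (PolVar _ 0 (inr a : J)) (polfun_g a)).
Qed.

Let polfun_powsum : polfun (E.*2 * 1) powsum.
Proof.
by apply: polfun_sum => j _; apply: (polfun_exp (f := fun v : J -> R => v j)); apply: PolVar.
Qed.

Let powsum_term (v : J -> R) j : 0 <= v j ^+ E.*2 <= powsum v.
Proof.
have ge0 (i : J) : 0 <= v i ^+ E.*2 by rewrite -mul2n exprM exprn_ge0// sqr_ge0.
by rewrite ge0/= /powsum (bigD1 j)//= lerDl sumr_ge0.
Qed.

Let powsum_ge0 v : 0 <= powsum v.
Proof.
by apply: sumr_ge0 => j _; case/andP: (powsum_term v j).
Qed.

Let Phi_term (v : J -> R) a : 0 <= (v (inr a) * g a v - 1) ^+ 2 <= Phi v.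
Proof.
by rewrite sqr_ge0/= /Phi (bigD1 a)//= lerDl sumr_ge0// => b _; rewrite sqr_ge0.
Qed.

Let Phi_ge0 v : 0 <= Phi v.
Proof. by apply: sumr_ge0 => a _; rewrite sqr_ge0. Qed.

(** The choice [z_a = 1 / g_a] makes [Phi] vanish. *)
Let v0 s (j : J) : R :=
  match j with inl i => x s i | inr a => (\prod_l f a l (x s))^-1 end.

(** Small enough that [eps * powsum (v0 s) < 1] for all [s] simultaneously. *)
Let eps : R := (1 + \sum_s powsum (v0 s))^-1.

Let eps_gt0 : 0 < eps.
Proof. by rewrite invr_gt0 ltr_pwDl// sumr_ge0. Qed.

Let Psi v := Phi v + eps * powsum v.

Hypothesis nz : forall s a l, f a l (x s) != 0.

Let Psi_v0 s : Psi (v0 s) = eps * powsum (v0 s).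
Proof.
rewrite /Psi /Phi big1 ?add0r// => a _.
by rewrite /g/= mulVf ?subrr ?expr0n//; apply/prodf_neq0.
Qed.

Let cell_critical s : exists v : J -> R,
  (forall a l, 0 < f a l (x s) * f a l (fun i => v (inl i))) /\
  forall j, is_derive (0 : R) 1 (fun t => Psi (move_coord v j t)) 0.
Proof.
(* The constraint [None] makes the closed cell bounded; its slack 1 above [powsum (v0 s)] keeps it
   inactive at the minimum. *)
pose c (t : option (A * L)) (v : J -> R) :=
  if t is Some (a, l) then f a l (x s) * f a l (fun i => v (inl i))
  else powsum (v0 s) + 1 - powsum v.
have pc t : exists e', polfun e' (c t).
  case: t => [[a l]|] /=.
    exists d; apply: polfun_scale.
    exact: (polfun_reindex inl (pf a l)).
  exists (E.*2 * 1)%N; rewrite /c.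
  by apply: polfun_sub => //; apply: PolConst.
have pPsi : polfun (2 * e.+1 + E.*2 * 1) Psi.
  apply: PolAdd; first by apply: polfun_weaken polfun_Phi; rewrite leq_addr.
  by apply: polfun_scale; apply: polfun_weaken polfun_powsum; rewrite leq_addl.
have [v vK vmin] : exists2 v, (forall t, 0 <= c t v) &
    forall w, (forall t, 0 <= c t w) -> Psi v <= Psi w.
  apply: (polfun_min (v0 := v0 s) (M := powsum (v0 s) + 1) pc pPsi).
    move=> v vK j; have := vK None; rewrite /c subr_ge0 => vb.
    have /andP[_ vj] := powsum_term v j.
    rewrite leNgt; apply/negP => big.
    have b1 : 1 <= `|v j| by apply: le_trans (ltW big); rewrite lerDr.
    suff : `|v j| <= v j ^+ E.*2 by move: (powsum_ge0 v); lra.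
    rewrite -mul2n exprM -real_normK ?num_real// -exprM.
    by rewrite -[leLHS]expr1 ler_weXn2l.
  move=> [[a l]|]; rewrite /c/=; first by rewrite -expr2 sqr_ge0.
  by rewrite addrAC subrr add0r.
have eps_s : eps * powsum (v0 s) < 1.
  rewrite mulrC ltr_pdivrMr ?mul1r; last by rewrite ltr_pwDl// sumr_ge0.
  by rewrite ltr_pwDl// (bigD1 s)//= lerDl sumr_ge0.
have v0K t : 0 <= c t (v0 s).
  case: t => [[a l]|]; rewrite /c/=; first by rewrite -expr2 sqr_ge0.
  by rewrite addrAC subrr add0r.
have Psi_v : Psi v <= eps * powsum (v0 s) by rewrite -Psi_v0; apply: vmin.
(* Comparison with [v0 s] gives [powsum v <= powsum (v0 s)], so the bound is strict. If some [f a l]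
   vanished, then [g a v = 0] and [Psi v] would be at least 1, against [eps_s]. *)
have cv t : 0 < c t v.
  case: t => [[a l]|] /=; last first.
    rewrite /c subr_gt0 (@le_lt_trans _ _ (powsum (v0 s)))// ?ltrDl//.
    rewrite -(ler_pM2l eps_gt0) (le_trans _ Psi_v)// /Psi lerDr//.
  have := vK (Some (a, l)); rewrite /c/= le0r => /orP[|//].
  rewrite mulf_eq0 (negbTE (nz _ _ _))/= => /eqP fal0.
  have /andP[_] := Phi_term v a.
  rewrite (_ : g a v = 0) ?mulr0 ?sub0r ?sqrrN ?expr1n; last first.
    by rewrite /g (bigD1 l)//= fal0 mul0r.
  move: Psi_v; rewrite /Psi; have := mulr_ge0 (ltW eps_gt0) (powsum_ge0 v).
  move: eps_s; lra.
exists v; split => [a l|j]; first exact: (cv (Some (a, l))).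
exact: (polfun_interior_min j pc pPsi cv vmin).
Qed.

Hypothesis separated : forall s s',
  (forall a l, 0 < f a l (x s) * f a l (x s')) -> s = s'.

Lemma card_strict_sign_patterns :
  (#|S| <= (2 * (#|L| * d) + 3) ^ (#|I| + #|A|))%N.
Proof.
have [v vP] := choice cell_critical.
have [h hP] := choice (fun j : J => let: ex_intro2 h p q := polfun_partial j polfun_Phi in
  ex_intro (fun h => polfun (2 * e.+1) h /\ forall v (t : R),
     is_derive t 1 (fun t => Phi (move_coord v j t)) (h (move_coord v j t))) h (conj p q)).
rewrite -card_sum -/e.
have -> : (2 * e + 3 = E.*2.-1)%N by rewrite /E; lia.
pose h' j w := - (eps * E.*2%:R)^-1 * h j w.
have eE0 : eps * E.*2%:R != 0 by rewrite mulf_neq0// ?gt_eqF// pnatr_eq0.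
apply: (@card_pure_power_zeros R J S v E.*2.-1 (2 * e.+1) h').
- by rewrite /E; lia.
- by move=> j; apply: polfun_scale; case: (hP j).
- move=> s j; have [_ /(_ j) crit] := vP s.
  have [_ /(_ (v s) 0) dPhi] := hP j.
  (* Along coordinate [j] only one term of [powsum] varies, so criticality reads
     [h j v + eps * 2E * v_j ^ (2E - 1) = 0]. *)
  pose rest := \sum_(i | i != j) v s i ^+ E.*2.
  have PsiE : (fun t : R => Psi (move_coord (v s) j t)) =
     (fun t => Phi (move_coord (v s) j t)) + (cst eps * ((cst (v s j) + id) ^+ E.*2 + cst rest)).
    apply/funext => t; rewrite !fctE /Psi /powsum (bigD1 j)//=.
    rewrite {2}/move_coord eqxx mulr1; congr (_ + _ * (_ + _)).
    by apply: eq_bigr => i /negbTE ij; rewrite /move_coord ij mulr0 addr0.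
  have dPsi : is_derive (0 : R) 1 (fun t => Psi (move_coord (v s) j t))
      (h j (v s) + eps * (E.*2%:R * v s j ^+ E.*2.-1)).
    rewrite PsiE; apply: is_derive_eq.
    rewrite move_coord0 scaler0 !addr0 add0r !fctE addr0.
    by rewrite /GRing.scale/= mulr1.
  have eq0 : h j (v s) + eps * (E.*2%:R * v s j ^+ E.*2.-1) = 0.
    by rewrite -(@derive_val _ _ _ _ _ _ _ dPsi) (@derive_val _ _ _ _ _ _ _ crit).
  rewrite /h' mulNr; apply: (mulfI eE0); rewrite mulrN mulVKf//.
  by apply/eqP; rewrite -addr_eq0 addrC -mulrA; apply/eqP.
(* A critical point shared by two cells has the signs of both samples: in the product of the two
   inequalities its value enters as a square and cancels. *)
- move=> s s' eqv; apply: separated => a l.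
  have [/(_ a l) p1 _] := vP s; have [/(_ a l) + _] := vP s'.
  rewrite -eqv => p2; have := mulr_gt0 p1 p2.
  set w := f a l (fun i => _); rewrite mulrACA -expr2 pmulr_lgt0//.
  rewrite lt_neqAle sqr_ge0 andbT eq_sym sqrf_eq0.
  by apply: contraTneq p1; rewrite -/w => ->; rewrite mulr0 ltxx.
Qed.

End SignPatterns.

Lemma card_sign_patterns (R : realType) (I A L S : finType) (d : nat)
    (f : A -> L -> (I -> R) -> R) (x : S -> I -> R) :
  (forall a l, polfun d (f a l)) ->
  (forall s s', (forall a l, (0 <= f a l (x s)) = (0 <= f a l (x s'))) -> s = s') ->
  (#|S| <= (2 * (#|L| * d) + 3) ^ (#|I| + #|A|))%N.
Proof.
move=> pf sep.
(* Adding a small [delta > 0] turns [0 <= f] into [0 < f + delta] on the sample. *)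
pose neg (p : S * A * L) := f p.1.2 p.2 (x p.1.1) < 0.
pose delta : R := \big[Num.min/1]_(p : S * A * L | neg p) (- f p.1.2 p.2 (x p.1.1) / 2).
have delta_gt0 : 0 < delta.
  rewrite /delta; elim/big_ind: _ => //.
    by move=> a b a0 b0; rewrite lt_min a0.
  by move=> p; rewrite /neg; lra.
have delta_lt s a l : f a l (x s) < 0 -> delta < - f a l (x s).
  move=> neg_s; apply: (@le_lt_trans _ _ (- f a l (x s) / 2)); last lra.
  exact: (@bigmin_le_cond _ _ _ _ (s, a, l) neg _ neg_s).
have sg s a l : (0 <= f a l (x s)) = (0 < f a l (x s) + delta).
  by apply/idP/idP => [|h]; [lra|rewrite leNgt; apply/negP => /delta_lt; lra].
apply: (@card_strict_sign_patterns R I A L S d (fun a l v => f a l v + delta) x).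
- by move=> a l; apply: PolAdd => //; apply: PolConst.
- move=> s a l; case: (ltP (f a l (x s)) 0) => [/delta_lt|]; first by move=> h; apply/eqP; lra.
  by move=> h; apply/eqP; lra.
- move=> s s' pos; apply: sep => a l; rewrite !sg.
  have := pos a l; case: (ltP 0 (f a l (x s) + delta)) => s0.
    by rewrite pmulr_rgt0// => ->.
  move=> p; apply/esym/negbTE; rewrite -leNgt.
  rewrite leNgt; apply/negP => s'0.
  by move: p; rewrite pmulr_lgt0// ltNge s0.
Qed.

(** * Basic solutions of the projected program *)

Section BasicSolutions.
Context {R : realFieldType} {m k : nat}.
Variables (B : 'M[R]_(m, k)) (b : 'cV[R]_m) (c : 'rV[R]_k) (H : R).

(* The rows of the identity allow any independent set of constraints to be completed to [k]
   independent equations. *)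
Definition ext_mx : 'M[R]_(m + k, k) := col_mx B 1%:M.
Definition ext_rhs : 'cV[R]_(m + k) := col_mx b 0.

Let feas (y : 'cV[R]_k) := forall i, (B *m y) i 0 <= b i 0.
Let obj (y : 'cV[R]_k) : R := (c *m y) 0 0.

Hypothesis bounded : forall y, feas y -> obj y <= H.

Let lineE p (M : 'M[R]_(p, k)) (y d : 'cV[R]_k) s i :
  (M *m (y + s *: d)) i 0 = (M *m y) i 0 + s * (M *m d) i 0.
Proof. by rewrite mulmxDr -scalemxAr !mxE. Qed.

(** Ratio test of the simplex method: advance along [d] to the first blocking constraint. The last
    clause later makes the new row independent of rows that annihilate [d]. *)
Let hit_constraint y (d : 'cV[R]_k) : feas y -> 0 <= obj d -> (exists i, 0 < (B *m d) i 0) ->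
  exists s r, [/\ feas (y + s *: d), obj y <= obj (y + s *: d),
    (ext_mx *m (y + s *: d)) r 0 = ext_rhs r 0 & (ext_mx *m d) r 0 != 0].
Proof.
move=> fy od [i0 i0P].
pose ratio i := (b i 0 - (B *m y) i 0) / (B *m d) i 0.
have [i iP imin] := Order.TotalTheory.arg_minP ratio (P := fun i => 0 < (B *m d) i 0) i0P.
have s0 : 0 <= ratio i by rewrite divr_ge0// ?subr_ge0// ltW.
exists (ratio i), (lshift k i); split.
- move=> j; rewrite lineE; have [jP|jN] := ltP 0 ((B *m d) j 0).
    by rewrite -lerBrDl -ler_pdivlMr//; apply: imin.
  by rewrite (le_trans _ (fy j))// gerDl mulr_ge0_le0.
- by rewrite /obj lineE lerDl mulr_ge0.
- rewrite /ext_mx /ext_rhs mul_col_mx !col_mxEu lineE /ratio divfK ?gt_eqF//.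
  by rewrite addrC subrK.
- by rewrite /ext_mx mul_col_mx col_mxEu gt_eqF.
Qed.

(* If [d] is a recession direction of the polyhedron, then it leaves the objective unchanged by
   boundedness, and moving along it can zero a coordinate. *)
Let hit_row y (d : 'cV[R]_k) : feas y -> d != 0 ->
  exists s r, [/\ feas (y + s *: d), obj y <= obj (y + s *: d),
    (ext_mx *m (y + s *: d)) r 0 = ext_rhs r 0 & (ext_mx *m d) r 0 != 0].
Proof.
move=> fy; wlog od : d / 0 <= obj d => [hw|] d0.
  have [od|od] := leP 0 (obj d); first exact: hw.
  have [||s [r [? ? ? nz]]] := hw (- d).
  - by rewrite /obj mulmxN mxE oppr_ge0 ltW.
  - by rewrite oppr_eq0.
  exists (- s), r; rewrite scaleNr -scalerN; split=> //.
  by move: nz; rewrite mulmxN mxE oppr_eq0.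
have [/existsP pos|/existsPn npos] := boolP [exists i, 0 < (B *m d) i 0].
  exact: hit_constraint.
have Bd_le0 i : (B *m d) i 0 <= 0 by rewrite leNgt npos.
have od0 : obj d = 0.
  apply/eqP; rewrite eq_le od andbT leNgt; apply/negP => od_gt0.
  (* At this step length the objective would equal [H + 1]. *)
  pose s := (H - obj y + 1) / obj d.
  have s0 : 0 <= s by rewrite divr_ge0//; have := bounded fy; lra.
  have : feas (y + s *: d).
    by move=> i; rewrite lineE (le_trans _ (fy i))// gerDl mulr_ge0_le0.
  by move/bounded; rewrite /obj lineE -/(obj y) -/(obj d) divfK ?gt_eqF//; lra.
have [/existsP[i neg]|/existsPn nneg] := boolP [exists i, (B *m d) i 0 < 0].
  have [|||s [r [? ? ? nz]]] := @hit_constraint y (- d) => //.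
  - by rewrite /obj mulmxN mxE -/(obj d) od0 oppr0.
  - by exists i; rewrite mulmxN mxE oppr_gt0.
  exists (- s), r; rewrite scaleNr -scalerN; split=> //.
  by move: nz; rewrite mulmxN mxE oppr_eq0.
have Bd0 i : (B *m d) i 0 = 0.
  by apply/eqP; rewrite eq_le Bd_le0 leNgt nneg.
have /cV0Pn[j dj] := d0.
exists (- (y j 0 / d j 0)), (rshift m j); split.
- by move=> i; rewrite lineE Bd0 mulr0 addr0.
- by rewrite /obj lineE -/(obj d) od0 mulr0 addr0.
- rewrite /ext_mx /ext_rhs mul_col_mx !col_mxEd lineE !mul1mx mulNr divfK// subrr.
  by rewrite mxE.
- by rewrite /ext_mx mul_col_mx col_mxEd mul1mx.
Qed.

(** With [j < k] independent tight rows there is a nonzero [d] they all annihilate; moving along [d]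
    keeps them tight until [hit_row] supplies one more. *)
Let tight_rows j y0 : (j <= k)%N -> feas y0 ->
  exists y (f : 'I_j -> 'I_(m + k)), [/\ feas y, obj y0 <= obj y,
    row_free (rowsub f ext_mx) & forall i, (ext_mx *m y) (f i) 0 = ext_rhs (f i) 0].
Proof.
move=> + fy0; elim: j => [_|j IH jk].
  have f : 'I_0 -> 'I_(m + k) by case.
  exists y0, f; split=> //.
    by apply: inj_row_free => v _; apply/matrixP => ? [].
  by case.
have [y [f [fy oy free tight]]] := IH (ltnW jk).
pose W := rowsub f ext_mx.
have [d d0 Wd] : exists2 d : 'cV_k, d != 0 & W *m d = 0.
  have : kermx W^T != 0.
    by rewrite -mxrank_eq0 mxrank_ker mxrank_tr (eqP free) subn_eq0 -ltnNge.
  move=> /rowV0Pn[v /sub_kermxP vW v0]; exists v^T.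
    by rewrite -trmx0 (inj_eq trmx_inj).
  by rewrite -[W]trmxK -trmx_mul vW trmx0.
have [s [r [fy' oy' tight_r dr]]] := hit_row fy d0.
pose f' (i : 'I_(1 + j)) := if fintype.split i is inr i' then f i' else r.
exists (y + s *: d), f'; split => //; first exact: le_trans oy'.
  have -> : rowsub f' ext_mx = col_mx (row r ext_mx) W.
    apply/matrixP => i l; rewrite [LHS]mxE [RHS]mxE /f'.
    by case: fintype.split => i'; rewrite [RHS]mxE.
  apply: inj_row_free => v; rewrite -(@hsubmxK R 1 1 j v).
  set a := lsubmx _; set u := rsubmx _.
  move=> prod0.
  have eq0 : a *m row r ext_mx + u *m W = 0 by rewrite -mul_row_col.
  (* Applying the dependence relation to [d] kills the old rows and leaves [a] times a nonzero
     scalar. *)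
  have a0 : a = 0.
    have := congr1 (fun M => (M *m d) 0 0) eq0.
    rewrite mulmxDl -!mulmxA Wd mulmx0 addr0 mul0mx mxE big_ord1 -row_mul !mxE.
    move=> /eqP; rewrite mulf_eq0; move: dr; rewrite mxE => /negbTE ->; rewrite orbF => /eqP a0.
    by apply/matrixP => i l; rewrite !ord1 /a !mxE.
  move: eq0; rewrite a0 mul0mx add0r => uW.
  have -> : u = 0 by apply: (row_free_inj free); rewrite -/W uW mul0mx.
  by rewrite row_mx0.
move=> i; rewrite /f'; case: fintype.split => [_|i'] //.
rewrite lineE tight; suff -> : (ext_mx *m d) (f i') 0 = 0 by rewrite mulr0 addr0.
have := congr1 (fun M : 'cV_j => M i' 0) Wd.
by rewrite /W mul_rowsub_mx [LHS]mxE [RHS]mxE.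
Qed.

(** On a singular matrix [invmx] returns the matrix itself, so this is meaningful only together with
    a [unitmx] condition. *)
Definition basic_sol (f : {ffun 'I_k -> 'I_(m + k)}) : 'cV[R]_k :=
  invmx (rowsub f ext_mx) *m rowsub f ext_rhs.

Lemma basic_sol_dominates y0 : feas y0 ->
  exists f : {ffun 'I_k -> 'I_(m + k)},
    [/\ rowsub f ext_mx \in unitmx, feas (basic_sol f) & obj y0 <= obj (basic_sol f)].
Proof.
move=> fy0; have [y [f [fy oy free tight]]] := tight_rows (leqnn k) fy0.
exists (finfun f); have -> : rowsub (finfun f) ext_mx = rowsub f ext_mx.
  by apply/matrixP => i j; rewrite !mxE ffunE.
rewrite -row_free_unit; suff -> : basic_sol (finfun f) = y by [].
rewrite /basic_sol; have -> : rowsub (finfun f) ext_mx = rowsub f ext_mx.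
  by apply/matrixP => i j; rewrite !mxE ffunE.
have -> : rowsub (finfun f) ext_rhs = rowsub f ext_mx *m y.
  apply/matrixP => i j; rewrite ord1 mul_rowsub_mx [LHS]mxE [RHS]mxE tight.
  by rewrite ffunE.
by rewrite mulKmx// -row_free_unit.
Qed.

End BasicSolutions.

(** * Thresholds of the optimal value as polynomial sign conditions *)

Section Threshold.
Context {R : realType} {n m : nat}.
Implicit Types (pi : lp_instance R n m) (k : nat).

(** Each feasible point is dominated by one of finitely many basic solutions, and [y = 0] is
    feasible, so the supremum is attained at the best feasible basic solution. *)
Lemma u_proj_ge k (P : 'M[R]_(n, k)) pi (H t : R) :
  lp_feasible pi 0 -> (forall x, lp_feasible pi x -> lp_obj pi x <= H) ->
  let B := inst_A pi *m P in
  t <= u_proj P pi <->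
  exists f : {ffun 'I_k -> 'I_(m + k)},
    let y := basic_sol B (inst_b pi) f in
    [/\ rowsub f (ext_mx B) \in unitmx, lp_feasible pi (P *m y) & t <= lp_obj pi (P *m y)].
Proof.
move=> f0 bd B.
have feasE (y : 'cV[R]_k) : lp_feasible pi (P *m y) <-> forall i, (B *m y) i 0 <= inst_b pi i 0.
  by rewrite /lp_feasible /cV_le mulmxA.
have objE (y : 'cV[R]_k) : lp_obj pi (P *m y) = ((inst_c pi)^T *m P *m y) 0 0.
  by rewrite /lp_obj mulmxA.
have dom (y : 'cV[R]_k) : lp_feasible pi (P *m y) ->
    exists f : {ffun 'I_k -> 'I_(m + k)},
      let y' := basic_sol B (inst_b pi) f in
      [/\ rowsub f (ext_mx B) \in unitmx, lp_feasible pi (P *m y')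
        & lp_obj pi (P *m y) <= lp_obj pi (P *m y')].
  move/feasE => fy; have [|f [uf ff of_]] :=
      basic_sol_dominates (c := (inst_c pi)^T *m P) (H := H) _ fy.
    by move=> z /feasE fz; rewrite -objE; apply: bd.
  by exists f => /=; split => //; [apply/feasE|rewrite !objE].
set V := [set lp_obj pi (P *m y) | y in [set y : 'cV[R]_k | lp_feasible pi (P *m y)]].
have V_ub : has_ubound V by exists H => _ [y /= fy <-]; apply: bd.
split=> [tu|[f [_ ff tf]]]; last first.
  apply: le_trans tf _; apply: ub_le_sup => //.
  by exists (basic_sol B (inst_b pi) f).
pose ok (f : {ffun 'I_k -> 'I_(m + k)}) := (rowsub f (ext_mx B) \in unitmx) &&
  `[< lp_feasible pi (P *m basic_sol B (inst_b pi) f) >].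
pose val (f : {ffun 'I_k -> 'I_(m + k)}) := lp_obj pi (P *m basic_sol B (inst_b pi) f).
have [|f0' [uf0 ff0 _]] := dom 0; first by rewrite mulmx0.
have okf0 : ok f0' by rewrite /ok uf0; apply/asboolP.
have [f /andP[uf /asboolP ff] fmax] := Order.TotalTheory.arg_maxP val okf0.
exists f; split => //; apply: le_trans tu _; apply: ge_sup.
  by exists (lp_obj pi (P *m (0 : 'cV[R]_k))), 0 => //=; rewrite mulmx0.
move=> _ [y /= fy <-]; have [g [ug fg yg]] := dom y fy.
by apply: le_trans yg _; apply: fmax; rewrite /ok ug; apply/asboolP.
Qed.

(* The signs of these polynomials say, in the order of the match, that [basic_sol f] is undefined,
   that its objective is at least [t], and that it satisfies constraint [i]. *)
Definition threshold_poly k pi (t : R) (f : {ffun 'I_k -> 'I_(m + k)})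
    (o : option (option 'I_m)) (x : 'I_n * 'I_k -> R) : R :=
  let P := \matrix_(i, j) x (i, j) in
  let Q := rowsub f (ext_mx (inst_A pi *m P)) in
  let q := \adj Q *m rowsub f (ext_rhs (k := k) (inst_b pi)) in
  match o with
  | None => - (\det Q * \det Q)
  | Some None => \det Q * (((inst_c pi)^T *m P *m q) 0 0 - t * \det Q)
  | Some (Some i) => \det Q * (inst_b pi i 0 * \det Q - (inst_A pi *m P *m q) i 0)
  end.

(** Entries of [Q] have degree at most 1, so determinant and adjugate have degree at most [k]; the
    largest total is [k + (1 + k) <= 3 * k], as [k] is positive. *)
Lemma polfun_threshold_poly k pi t f o : (0 < k)%N ->
  polfun (3 * k) (@threshold_poly k pi t f o).
Proof.
move=> k0; rewrite /threshold_poly.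
pose Pm (x : 'I_n * 'I_k -> R) : 'M[R]_(n, k) := \matrix_(i, j) x (i, j).
have pM p (M : 'M[R]_(p, n)) i j : polfun 1 (fun x => (M *m Pm x) i j).
  under eq_fun do rewrite mxE; apply: polfun_sum => l _.
  by under eq_fun do rewrite mxE; apply: polfun_scale; apply: PolVar.
pose Qm x := rowsub f (ext_mx (inst_A pi *m Pm x)).
have pQ i j : polfun 1 (fun x => Qm x i j).
  under eq_fun do rewrite /Qm mxE /ext_mx mxE.
  by case: fintype.split => l; [apply: pM|apply: PolConst].
have pD : polfun k (fun x => \det (Qm x)).
  by rewrite -[k in polfun k]muln1; apply: polfun_det.
have padj i j : polfun k (fun x => (\adj (Qm x)) i j).
  under eq_fun do rewrite mxE /cofactor.
  apply: polfun_scale; apply: (@polfun_weaken _ _ (k.-1 * 1)); first lia.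
  by apply: polfun_det => a a'; under eq_fun do rewrite 2!mxE; apply: pQ.
pose qm x := \adj (Qm x) *m rowsub f (ext_rhs (k := k) (inst_b pi)).
have pq i j : polfun k (fun x => qm x i j).
  under eq_fun do rewrite mxE; apply: polfun_sum => l _.
  by under eq_fun do rewrite mulrC; apply: polfun_scale.
have pMq p (M : 'M[R]_(p, n)) i j : polfun (1 + k) (fun x => (M *m Pm x *m qm x) i j).
  under eq_fun do rewrite mxE; apply: polfun_sum => l _.
  by apply: PolMul; [apply: pM|apply: pq].
have pcD r : polfun (1 + k) (fun x => r * \det (Qm x)).
  by apply: polfun_scale; apply: polfun_weaken pD.
case: o => [[i|]|].
- apply: (@polfun_weaken _ _ (k + (1 + k))); first lia.
  by apply: (PolMul pD); apply: polfun_sub => //; apply: pMq.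
- apply: (@polfun_weaken _ _ (k + (1 + k))); first lia.
  by apply: (PolMul pD); apply: polfun_sub => //; apply: pMq.
- apply: (@polfun_weaken _ _ (k + k)); first lia.
  by apply: polfun_opp; apply: PolMul.
Qed.

(** By Cramer's rule the basic solution is [q / \det Q]; multiplying each inequality by the positive
    [\det Q ^ 2] clears denominators. *)
Lemma threshold_polyP k pi (t H : R) (x : 'I_n * 'I_k -> R) :
  lp_feasible pi 0 -> (forall z, lp_feasible pi z -> lp_obj pi z <= H) ->
  (t <= u_proj (\matrix_(i, j) x (i, j)) pi) =
  [exists f : {ffun 'I_k -> 'I_(m + k)},
    [&& ~~ (0 <= threshold_poly pi t f None x), 0 <= threshold_poly pi t f (Some None) x
      & [forall i, 0 <= threshold_poly pi t f (Some (Some i)) x]]].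
Proof.
move=> f0 bd; set P := \matrix_(i, j) x (i, j).
have key (f : {ffun 'I_k -> 'I_(m + k)}) (y := basic_sol (inst_A pi *m P) (inst_b pi) f) :
    [/\ rowsub f (ext_mx (inst_A pi *m P)) \in unitmx, lp_feasible pi (P *m y)
      & t <= lp_obj pi (P *m y)] <->
    [&& ~~ (0 <= threshold_poly pi t f None x), 0 <= threshold_poly pi t f (Some None) x
      & [forall i, 0 <= threshold_poly pi t f (Some (Some i)) x]].
  rewrite /threshold_poly -/P; set Q := rowsub f _; set q := \adj Q *m _.
  (* Invertibility becomes a sign condition: minus a square is negative exactly when the determinant
     is nonzero. *)
  have unitE : (Q \in unitmx) = ~~ (0 <= - (\det Q * \det Q)).
    rewrite unitmxE unitfE -expr2 oppr_ge0 -ltNge lt_neqAle sqr_ge0 andbT.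
    by rewrite [0 == _]eq_sym sqrf_eq0.
  have yE : Q \in unitmx -> forall p (M : 'M[R]_(p, n)) i,
      (M *m (P *m y)) i 0 = (\det Q)^-1 * (M *m P *m q) i 0.
    move=> uQ p M i; rewrite /y /basic_sol -/Q /invmx uQ mulmxA -/q.
    by rewrite -scalemxAl -scalemxAr mxE.
  have ge_scaled (a z : R) : \det Q != 0 ->
      (0 <= \det Q * (a * \det Q - z)) = ((\det Q)^-1 * z <= a).
    move=> D0; have D2 : 0 < \det Q * \det Q by rewrite -expr2 lt_neqAle sqr_ge0 eq_sym sqrf_eq0 D0.
    rewrite -[in RHS](ler_pM2l D2) -subr_ge0; congr (0 <= _).
    by field.
  have le_scaled (a z : R) : \det Q != 0 ->
      (0 <= \det Q * (z - a * \det Q)) = (a <= (\det Q)^-1 * z).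
    move=> D0; have D2 : 0 < \det Q * \det Q by rewrite -expr2 lt_neqAle sqr_ge0 eq_sym sqrf_eq0 D0.
    rewrite -[in RHS](ler_pM2l D2) -subr_ge0; congr (0 <= _).
    by field.
  split=> [[uQ fy oy]|/and3P[uQ oy /forallP fy]].
    rewrite -unitE uQ /=; move: (uQ); rewrite unitmxE unitfE => D0.
    rewrite le_scaled// -yE// oy/=; apply/forallP => i.
    by rewrite ge_scaled// -yE.
  rewrite -unitE in uQ; move: (uQ); rewrite unitmxE unitfE => D0; split=> //.
    by move=> i; rewrite yE// -ge_scaled.
  by rewrite /lp_obj yE// -le_scaled.
apply/idP/existsP => [/(u_proj_ge P t f0 bd)[f /key fP]|[f /key fP]].
  by exists f.
by apply/(u_proj_ge P t f0 bd); exists f.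
Qed.

End Threshold.

(** * Counting shattered instances *)

(** With [w = k * l], the factors are at most [2 ^ (w + 5)], [2 ^ w], [2 ^ w.+1] and [2 ^ 2], using
    [m + k <= 2mk]. The base is below [2 ^ (3w + 10)], and [6w + 20 <= 30w] since [w >= 1]. *)
Lemma sign_pattern_count_small (m k : nat) (l := up_log 2 (2 * (m * k)))
    (K := (30 * (k * l))%N) : (0 < m)%N -> (0 < k)%N ->
  ((2 * (K * ((m + k) ^ k * m.+2) * (3 * k)) + 3) ^ 2 < 2 ^ K)%N.
Proof.
move=> m0 k0.
have mk0 : (0 < m * k)%N by rewrite muln_gt0 m0.
have le_l : (2 * (m * k) <= 2 ^ l)%N by apply: up_logP.
have l0 : (0 < l)%N.
  by rewrite lt0n; apply: contraTneq le_l => ->; rewrite expn0 -ltnNge; lia.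
pose w := (k * l)%N.
have w0 : (0 < w)%N by rewrite muln_gt0 k0.
have lw : (l <= w)%N by rewrite leq_pmull.
have b1 : ((m + k) ^ k <= 2 ^ w)%N.
  rewrite /w mulnC expnM leq_exp2r//; apply: leq_trans le_l; nia.
have b2 : (m.+2 * k <= 2 ^ l.+1)%N by rewrite expnS; nia.
have b3 : (K <= 2 ^ (w + 5))%N.
  have := ltn_expl w (ltnSn 1); rewrite expnD /K -/w; lia.
have b4 : (2 ^ l.+1 <= 2 ^ w.+1)%N by rewrite leq_exp2l.
have e_le : (K * ((m + k) ^ k * m.+2) * (3 * k) <= 2 ^ (3 * w + 8))%N.
  have -> : (K * ((m + k) ^ k * m.+2) * (3 * k) = K * (m + k) ^ k * (m.+2 * k) * 3)%N by ring.
  have -> : (3 * w + 8 = (w + 5) + w + w.+1 + 2)%N by lia.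
  by rewrite !(expnD 2 _ 2) expnD [(2 ^ (w + 5 + w))%N]expnD !leq_mul// (leq_trans b2).
have lt1 : (2 * (K * ((m + k) ^ k * m.+2) * (3 * k)) + 3 < 2 ^ (3 * w + 10))%N.
  have -> : (3 * w + 10 = (3 * w + 8) + 2)%N by lia.
  rewrite expnD; have : (2 ^ 3 <= 2 ^ (3 * w + 8))%N by rewrite leq_exp2l//; lia.
  move: e_le; set z := (2 ^ (3 * w + 8))%N; rewrite (_ : 2 ^ 3 = 8)%N// (_ : 2 ^ 2 = 4)%N//; lia.
apply: (@leq_trans ((2 ^ (3 * w + 10)) ^ 2)); first by rewrite ltn_exp2r.
by rewrite -expnM leq_exp2l// /K -/w; lia.
Qed.

(** From [2 ^ (l - 1) < 2x] follows [l <= 2 + ln x / ln 2]. The summand 1 next to [ln x] keeps the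
    bound positive at [x = 1]. *)
Lemma up_log2_le_ln (R : realType) (x : nat) : (0 < x)%N ->
  (up_log 2 (2 * x))%:R <= (2 + (ln 2)^-1) * (1 + ln x%:R) :> R.
Proof.
move=> x0; set l := up_log _ _.
have ln2 : 0 < ln 2 :> R by rewrite ln_gt0// ltr1n.
have lnx : 0 <= ln x%:R :> R by rewrite ln_ge0// ler1n.
have x2 : (1 < 2 * x)%N by lia.
have /andP[+ _] := up_log_bounds (ltnSn 1) x2.
rewrite -/l -(ltr_nat R) natrX natrM => lt.
have : l.-1%:R * ln 2 <= ln 2 + ln x%:R :> R.
  have xR : (0 < x%:R :> R) by rewrite ltr0n.
  rewrite -lnM ?posrE// mulr_natl -lnXn// ler_ln ?posrE ?exprn_gt0 ?mulr_gt0//.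
  exact: ltW.
rewrite -ler_pdivlMr// mulrDl divff ?gt_eqF// => lt1.
have : l%:R <= l.-1%:R + 1 :> R by rewrite natr1 ler_nat; lia.
have iln2 : 0 < (ln 2)^-1 :> R by rewrite invr_gt0.
move: lt1; have := mulr_ge0 (ltW iln2) lnx; rewrite [ln x%:R / _]mulrC; nra.
Qed.

Lemma shattered_count (R : realType) (n k m K : nat) (H : R)
    (Pi : set (lp_instance R n m)) (s : seq (lp_instance R n m)) :
  (0 < k)%N -> (0 < n)%N ->
  (forall pi, Pi pi -> lp_feasible pi 0) ->
  (forall pi, Pi pi -> forall x, lp_feasible pi x -> lp_obj pi x <= H) ->
  {subset s <= Pi} ->
  pshattered [set u | exists P : 'M[R]_(n, k),
                        forall pi, Pi pi -> u pi = u_proj P pi] s ->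
  (n * k * K <= size s)%N ->
  (2 ^ K <= (2 * (K * ((m + k) ^ k * m.+2) * (3 * k)) + 3) ^ 2)%N.
Proof.
move=> k0 n0 feas0 bounded sPi [_ [t shatter]] large.
(* There are as many groups as entries of [P], each holding [K] instances, so both counts contribute
   equally to the exponent [2nk]. *)
pose A : finType := ('I_n * 'I_k)%type.
pose L : finType := ('I_K * ({ffun 'I_k -> 'I_(m + k)} * option (option 'I_m)))%type.
have cardA : #|A| = (n * k)%N by rewrite card_prod !card_ord.
have cardAK : (#|{: A * 'I_K}| <= size s)%N by rewrite card_prod cardA card_ord.
pose idx (p : A * 'I_K) : 'I_(size s) := widen_ord cardAK (enum_rank p).
have idx_inj : injective idx.
  by move=> p q /(congr1 val)/= eq; apply/enum_rank_inj/val_inj.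
pose inst p := tnth (in_tuple s) (idx p).
have inst_Pi p : Pi (inst p) by apply/set_mem/sPi; apply: mem_tnth.
(* A pattern on the selected instances is padded with [false] on the rest of [s]. *)
have realise (phi : {ffun A * 'I_K -> bool}) : exists P : 'M[R]_(n, k),
    forall p, (t (idx p) <= u_proj P (inst p)) = phi p.
  have [u [P uP] pat] := shatter (fun i => [exists p, (idx p == i) && phi p]).
  exists P => p; rewrite -uP// pat; apply/existsP/idP => [[q /andP[/eqP]]|phip].
    by move=> /idx_inj ->.
  by exists p; rewrite eqxx.
have [P PP] := choice realise.
pose x phi (ij : 'I_n * 'I_k) := P phi ij.1 ij.2.
have xE phi : \matrix_(i, j) x phi (i, j) = P phi.
  by apply/matrixP => i j; rewrite mxE.
pose f (a : A) (l : L) := threshold_poly (inst (a, l.1)) (t (idx (a, l.1))) l.2.1 l.2.2.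
have pf a l : polfun (3 * k) (f a l) by apply: polfun_threshold_poly.
have := card_sign_patterns (x := x) pf; rewrite card_ffun card_bool card_prod.
rewrite cardA card_prod card_prod card_ffun !card_option !card_ord.
have nk0 : (0 < n * k)%N by rewrite muln_gt0 n0.
(* Both sides are [nk]-th powers; the root is taken here, which removes [n] from the inequality. *)
rewrite addnn -mul2n [(n * k * K)%N]mulnC (expnM 2 K) (expnM _ 2) leq_exp2r//; apply.
move=> phi phi' eqs; apply/ffunP => -[a i]; rewrite -!PP -!xE.
have bd := bounded _ (inst_Pi (a, i)); have f0 := feas0 _ (inst_Pi (a, i)).
rewrite !(threshold_polyP _ _ f0 bd).
have eqf g o : (0 <= threshold_poly (inst (a, i)) (t (idx (a, i))) g o (x phi)) =
               (0 <= threshold_poly (inst (a, i)) (t (idx (a, i))) g o (x phi')).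
  exact: eqs a (i, (g, o)).
apply: eq_existsb => g; rewrite !eqf; congr [&& _, _ & _].
by apply: eq_forallb => j; rewrite eqf.
Qed.

Unset Implicit Arguments.

Theorem theorem1 (R : realType) :
  exists C : R, 0 < C /\
  forall (n k m : nat) (H : R) (Pi : set (lp_instance R n m)),
    (0 < k)%N -> (k < n)%N -> (0 < m)%N -> 0 < H ->
    (forall pi, Pi pi -> lp_feasible pi 0) ->
    (forall pi, Pi pi -> forall x, lp_feasible pi x -> lp_obj pi x <= H) ->
    forall s : seq (lp_instance R n m),
      {subset s <= Pi} ->
      pshattered [set u | exists P : 'M[R]_(n, k),
                            forall pi, Pi pi -> u pi = u_proj P pi] s ->
      (size s)%:R <= C * (n * k ^ 2)%:R * (1 + ln ((m * k)%:R)).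
Proof.
have ln2 : 0 < ln 2 :> R by rewrite ln_gt0// ltr1n.
pose c : R := 2 + (ln 2)^-1.
have c0 : 0 < c by rewrite addr_gt0// invr_gt0.
(* The 30 comes from [K = 30 * (k * l)], and [c] from bounding [l] by [c * (1 + ln (m * k))]. *)
exists (30 * c); split; first by rewrite mulr_gt0.
move=> n k m H Pi k0 kn m0 _ feas0 bounded s sPi shatter.
pose l := up_log 2 (2 * (m * k)).
have n0 : (0 < n)%N by apply: leq_ltn_trans kn.
have small : (size s <= n * k * (30 * (k * l)))%N.
  rewrite leqNgt; apply/negP => /ltnW large.
  have := shattered_count k0 n0 feas0 bounded sPi shatter large.
  by rewrite leqNgt sign_pattern_count_small.
have mk0 : (0 < m * k)%N by rewrite muln_gt0 m0.
have lR := @up_log2_le_ln R _ mk0.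
apply: (@le_trans _ _ ((n * k ^ 2)%:R * 30 * l%:R)).
  rewrite -!natrM ler_nat; apply: leq_trans small _.
  by rewrite leq_eqVlt; apply/orP; left; apply/eqP; ring.
rewrite -/l -/c in lR.
have -> : 30 * c * (n * k ^ 2)%:R * (1 + ln (m * k)%:R) =
  (n * k ^ 2)%:R * 30 * (c * (1 + ln (m * k)%:R)) :> R by ring.
by rewrite ler_wpM2l// mulr_ge0.
Qed.
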